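(* Let $G$ be a graph on $n$ vertices with minimum degree $\delta(G) \geq \frac{1}{2}n + 7$. Then the set $\mathcal{H}_G$ of all Hamiltonian cycles of $G$ is $10$-switch irreducible. Moreover, the class of all graphs $G$ satisfying $\delta(G) \geq \frac{1}{2}n+7$, where $n$ denotes the number of vertices of $G$, is strongly $10$-switch irreducible for Hamiltonian cycles.
   Context: All graphs are finite, simple and undirected. $\mathcal{H}_G$ denotes the set of all Hamiltonian cycles of $G$, each viewed as a spanning subgraph of $G$. For graphs on the same vertex set, $\triangle$ denotes symmetric difference of edge sets. A switch of size $j$ (with respect to $\mathcal{H}_G$) transforms some $H\in\mathcal{H}_G$ into some $H'\in\mathcal{H}_G$ by removing exactly $j$ edges of $H$ and adding exactly $j$ edges not in $H$; a $k$-switch is a switch of size at most $k$. $\mathcal{H}_G$ is $k$-switch irreducible if for all $H_1,H_2\in\mathcal{H}_G$ there is a sequence $H_1=Z_1,\dots,Z_q=H_2$ of elements of $\mathcal{H}_G$ such that every consecutive pair $(Z_i,Z_{i+1})$ differs by a $k$-switch. A class $\mathcal{G}$ of graphs is strongly $k$-switch irreducible for Hamiltonian cycles if there exists a function $\phi:\mathbb{N}\to\mathbb{N}$ such that for all $G\in\mathcal{G}$ and all $H_1,H_2\in\mathcal{H}_G$ with $|E(H_1)\triangle E(H_2)|\le x$, there is a sequence $H_1=Z_1,\dots,Z_q=H_2$ of elements of $\mathcal{H}_G$ such that every consecutive pair differs by a $k$-switch and $q\le\phi(x)$. *)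

(* Defs.v *)
From mathcomp Require Import all_boot all_order all_algebra.

Set Implicit Arguments.
Unset Strict Implicit.
Unset Printing Implicit Defensive.

Record sgraph := SGraph {
  vertex :> finType;
  edge : rel vertex;
  edge_sym : symmetric edge;
  edge_irr : irreflexive edge
}.

Definition degree (G : sgraph) (v : G) : nat := #|[set w : G | edge v w]|.

(* The starting value #|G| exceeds every degree, so it only matters for the
   graph without vertices. *)
Definition min_degree (G : sgraph) : nat := \big[minn/#|G|]_(v : G) degree v.

(* Edges are unordered pairs; a spanning subgraph of a graph on T is given by
   its edge set, of type {set {set T}}. *)
Definition cycle_edges (T : finType) (c : seq T) : {set {set T}} :=
  [set [set x; next c x] | x in c].

(* The bound on #|G| excludes the degenerate closed walks on at most two
   vertices that ucycleb accepts; a repetition-free #|G|-tuple visits every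
   vertex exactly once. *)
Definition ham_cycles (G : sgraph) : {set {set {set G}}} :=
  [set cycle_edges c | c : #|G|.-tuple G & (2 < #|G|) && ucycleb (@edge G) c].

Definition symdiff (T : finType) (A B : {set T}) : {set T} :=
  (A :\: B) :|: (B :\: A).

Definition is_switch (G : sgraph) (j : nat) (H H' : {set {set G}}) : bool :=
  [&& H \in ham_cycles G, H' \in ham_cycles G,
      #|H :\: H'| == j & #|H' :\: H| == j].

Definition is_kswitch (G : sgraph) (k : nat) : rel {set {set G}} :=
  fun H H' => [exists j : 'I_k.+1, is_switch j H H'].

(* The sequence Z_1, ..., Z_q is H1 :: p, so q = (size p).+1. *)
Definition kswitch_sequence (G : sgraph) (k : nat) (H1 H2 : {set {set G}})
    (p : seq {set {set G}}) : Prop :=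
  [/\ {subset H1 :: p <= ham_cycles G}, path (@is_kswitch G k) H1 p
    & last H1 p = H2].

Definition kswitch_irreducible (k : nat) (G : sgraph) : Prop :=
  forall H1 H2 : {set {set G}},
    H1 \in ham_cycles G -> H2 \in ham_cycles G ->
    exists p : seq {set {set G}}, kswitch_sequence k H1 H2 p.

Definition strongly_kswitch_irreducible (k : nat) (C : sgraph -> Prop) : Prop :=
  exists phi : nat -> nat,
    forall G : sgraph, C G ->
    forall (x : nat) (H1 H2 : {set {set G}}),
      H1 \in ham_cycles G -> H2 \in ham_cycles G -> #|symdiff H1 H2| <= x ->
      exists p : seq {set {set G}},
        kswitch_sequence k H1 H2 p /\ size (H1 :: p) <= phi x.

Definition large_min_degree (G : sgraph) : Prop :=
  (2^-1 * (#|G|)%:R + 7%:R <= (min_degree G)%:R :> rat)%R.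

(* Main.v *)
Require Import Defs.
From mathcomp Require Import all_boot all_order all_algebra.
From mathcomp Require Import zify lra.

Set Implicit Arguments.
Unset Strict Implicit.
Unset Printing Implicit Defensive.

(** One switch of size at most 10 always brings a Hamiltonian cycle H1 strictly
    closer to a target H2: it can be made to increase the number of common
    edges. Repeating this reaches H2 after at most as many switches as there
    are edges in H2 \ H1, which gives both claims with phi(x) = x + 1. The
    closer cycle is found in two stages, of which only the second uses the
    degree condition.

    The first stage takes place in H1 and H2 alone. Delete from H1 an edge
    outside H2, leaving a Hamiltonian path. More generally, suppose that a
    spanning linear forest L with v paths is given, and let z be an end of one
    of its paths. As z has degree at most one in L, some edge za of H2 is
    missing. Adding za forces the deletion of an edge at a if a is not itself an
    end, and since a has degree two in H2, some edge of L at a then lies outside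
    H2. Either the result is again a forest of v paths, with one more edge of H2;
    or za closes a cycle C.
    In the second case H2, being connected, has an edge cd that leaves C; one
    of the two edges of C at c is outside H2, so C can be opened there and the
    path so obtained attached along cd, again by deleting an edge outside H2 at
    d. This yields v + 1 paths and two more edges of H2. Either way the excess
    (edges of H2 gained) - (number of paths) rises by at least one, and no edge
    of H2 is ever deleted ([gain_progress]). It starts at -1, so two rounds
    produce a forest with v paths and b > v new edges of H2, and (v, b) is
    (1, 2), (2, 3) or (3, 4); or else a Hamiltonian cycle appears on the way
    ([gain_almost_hamiltonian]).

    The second stage closes L up in G. Linking the v paths cyclically costs at
    most v edges, possibly not in G. Each of these is removed by Ore's exchange:
    if u and w are the ends of a Hamiltonian path and their degrees add up to
    more than n, there are consecutive a, b on the path with ua and wb edges of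
    G, and ab, uw can be traded for ua, wb. Such an exchange destroys at most
    one edge of G ([ore_closing]). Hence at most v edges of L are lost, fewer
    than the b edges of H2 that were gained. The forest L misses at most v + b
    edges of H1, so the resulting cycle misses at most 2 v + b <= 10 of them
    ([closer_hamiltonian_cycle]). *)

(** * Edge sets of paths and spanning cycles *)

Lemma set2_inj (T : finType) (a b x y : T) :
  [set a; b] = [set x; y] -> (a = x /\ b = y) \/ (a = y /\ b = x).
Proof.
move=> E.
have := set21 a b; rewrite E => /set2P Ha.
have := set22 a b; rewrite E => /set2P Hb.
have := set21 x y; rewrite -E => /set2P Hx.
have := set22 x y; rewrite -E => /set2P Hy.
intuition congruence.
Qed.

Fixpoint walk_edges (T : finType) (x : T) (s : seq T) : {set {set T}} :=
  if s is y :: s' then [set x; y] |: walk_edges y s' else set0.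

Definition path_edges (T : finType) (s : seq T) : {set {set T}} :=
  if s is x :: s' then walk_edges x s' else set0.

Lemma path_edges_cat (T : finType) (s t : seq T) (x y : T) :
  path_edges (rcons s x ++ y :: t) =
  [set x; y] |: (path_edges (rcons s x) :|: path_edges (y :: t)).
Proof.
case: s => [|z s] /=; first by rewrite set0U.
elim: s z => [|w s IHs] z /=; first by rewrite setU0 setUCA.
by rewrite IHs !setUA [X in X :|: _ :|: _]setUC.
Qed.

Lemma path_edges_rcons2 (T : finType) (s : seq T) (x y : T) :
  path_edges (rcons (rcons s x) y) = [set x; y] |: path_edges (rcons s x).
Proof. by rewrite -[in LHS]cats1 path_edges_cat /= setU0. Qed.

Lemma path_edges_rev (T : finType) (s : seq T) :
  path_edges (rev s) = path_edges s.
Proof.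
case: s => [|x s] //=; elim: s x => [|y s IHs] x //=.
by rewrite rev_cons rev_cons path_edges_rcons2 -rev_cons IHs setUC [[set y; x]]setUC setUC.
Qed.

Lemma path_edges_mem (T : finType) (s : seq T) (x y : T) :
  [set x; y] \in path_edges s -> (x \in s) && (y \in s).
Proof.
case: s => [|z s] /=; first by rewrite inE.
elim: s z => [|w s IHs] z /=; first by rewrite inE.
rewrite !inE => /orP[/eqP/set2_inj[[-> ->]|[-> ->]]|/IHs/andP[]].
- by rewrite !eqxx !orbT.
- by rewrite !eqxx !orbT.
by rewrite !inE => -> ->; rewrite !orbT.
Qed.

Lemma cycle_edges_cons (T : finType) (x : T) (s : seq T) :
  uniq (x :: s) -> cycle_edges (x :: s) = [set last x s; x] |: path_edges (x :: s).
Proof.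
rewrite /cycle_edges /=.
have Hgen : forall y0 y, uniq (y :: s) ->
    [set [set z; next_at z y0 y s] | z in y :: s] = [set last y s; y0] |: walk_edges y s.
  elim: s => [|w s IHs] y0 y /=.
    move=> _; apply/setP=> e; rewrite setU0 !inE.
    apply/imsetP/eqP => [[z]|->]; first by rewrite inE => /eqP-> ->; rewrite eqxx.
    by exists y; rewrite ?inE ?eqxx.
  case/andP=> yNs Us.
  rewrite setUCA -(IHs y0 w Us).
  apply/setP=> e; rewrite !inE; apply/imsetP/idP => [[z]|].
    rewrite inE => /orP[/eqP->|zs] ->; first by rewrite !eqxx.
    have /negPf-> : z != y by apply: contraNneq yNs => <-.
    by apply/orP; right; apply: imset_f.
  case/orP=> [/eqP->|/imsetP[z zs ->]].
    by exists y; rewrite ?inE ?eqxx.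
  exists z; first by rewrite inE zs orbT.
  by have /negPf-> : z != y by apply: contraNneq yNs => <-.
exact: Hgen.
Qed.

Lemma cycle_edges_rot (T : finType) (n : nat) (c : seq T) :
  uniq c -> cycle_edges (rot n c) = cycle_edges c.
Proof.
move=> Uc; rewrite /cycle_edges; apply/setP=> e.
apply/imsetP/imsetP=> -[x xc ->]; exists x; rewrite ?next_rot ?mem_rot //.
  by rewrite mem_rot in xc.
Qed.

Definition spanning (T : finType) (c : seq T) : bool := perm_eq c (enum T).

Lemma spanning_uniq (T : finType) (c : seq T) : spanning c -> uniq c.
Proof. by move/perm_uniq->; rewrite enum_uniq. Qed.

Lemma mem_spanning (T : finType) (c : seq T) (x : T) : spanning c -> x \in c.
Proof. by move/perm_mem->; rewrite mem_enum. Qed.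

Lemma spanning_size (T : finType) (c : seq T) : spanning c -> size c = #|T|.
Proof. by move/perm_size->; rewrite cardE. Qed.

Lemma uniq_spanning (T : finType) (c : seq T) :
  uniq c -> (forall x, x \in c) -> spanning c.
Proof.
move=> Uc cT; apply: uniq_perm => //; first exact: enum_uniq.
by move=> x; rewrite cT mem_enum.
Qed.

Lemma spanning_rot_to (T : finType) (c : seq T) (x : T) :
  spanning c -> exists2 s, spanning (x :: s) & cycle_edges (x :: s) = cycle_edges c
    /\ next (x :: s) =1 next c.
Proof.
move=> Sc; have [i s Es] := rot_to (mem_spanning x Sc).
have Uc := spanning_uniq Sc.
exists s; rewrite -Es ?cycle_edges_rot //.
  by rewrite /spanning perm_rot.
by split=> // y; rewrite next_rot.
Qed.

Lemma next_neq (T : finType) (c : seq T) (x : T) :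
  spanning c -> 2 < #|T| -> next c x != x /\ next c (next c x) != x.
Proof.
move=> Sc n3; have [s Ss [_ Es]] := spanning_rot_to x Sc.
rewrite -!Es; have := spanning_size Ss; have := spanning_uniq Ss.
case: s {Ss Es} => [|y [|z s]] /=; try by move=> _ E; rewrite -E in n3.
rewrite !inE !negb_or -!andbA => /and5P[xy xz xs yz _] _.
by rewrite eqxx [y == x]eq_sym (negPf xy) eqxx [z == x]eq_sym xz.
Qed.

Lemma mem_cycle_edges (T : finType) (c : seq T) (x y : T) :
  spanning c -> ([set x; y] \in cycle_edges c) = (y == next c x) || (y == prev c x).
Proof.
move=> Sc; have Uc := spanning_uniq Sc; apply/imsetP/idP.
  case=> z zc /set2_inj[[-> ->]|[-> ->]]; first by rewrite eqxx.
  by rewrite prev_next // eqxx orbT.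
case/orP=> /eqP->; first by exists x; rewrite ?mem_spanning.
exists (prev c x); rewrite ?mem_spanning // next_prev //.
by rewrite setUC.
Qed.

Lemma card_cycle_edges (T : finType) (c : seq T) :
  spanning c -> 2 < #|T| -> #|cycle_edges c| = #|T|.
Proof.
move=> Sc n3; rewrite /cycle_edges card_in_imset.
  by rewrite (card_uniqP _) ?spanning_size ?spanning_uniq.
move=> x y _ _ /set2_inj[[]//|[Ex Ey]].
have [_] := next_neq y Sc n3; by rewrite -Ex Ey eqxx.
Qed.

(** The properties of a spanning cycle that the construction of forests uses. The
    first clause bounds degrees from below in the form needed to leave [z]
    along an edge not ending in a prescribed neighbour [y]; the second bounds
    them from above by two; the third says that every cut is crossed. *)
Definition connected_2regular (T : finType) (H : {set {set T}}) : Prop :=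
  [/\ forall z y : T, exists a, [/\ a != z, a != y & [set z; a] \in H],
      forall a x y w : T, uniq [:: x; y; w] -> [set a; x] \in H ->
        [set a; y] \in H -> [set a; w] \notin H
    & forall (C : {pred T}) (z u : T), z \in C -> u \notin C ->
        exists c d, [/\ c \in C, d \notin C & [set c; d] \in H]].

Lemma cycle_edges_2regular (T : finType) (c : seq T) :
  spanning c -> 2 < #|T| -> connected_2regular (cycle_edges c).
Proof.
move=> Sc n3; have Uc := spanning_uniq Sc; split.
- move=> z y; have [nz nnz] := next_neq z Sc n3.
  have [pz _] := next_neq (prev c z) Sc n3.
  rewrite next_prev // in pz.
  have np : next c z != prev c z.
    by apply: contraNneq nnz => ->; rewrite next_prev.
  have [Ey|ny] := eqVneq (next c z) y.
    by exists (prev c z); rewrite mem_cycle_edges // eqxx orbT eq_sym pz eq_sym -Ey.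
  by exists (next c z); rewrite mem_cycle_edges // eqxx.
- move=> a x y w; rewrite !mem_cycle_edges //= !inE negb_or andbT => /andP[/andP[xy xw] yw].
  by case/orP=> /eqP Ex /orP[]/eqP Ey; subst; rewrite ?eqxx // in xy *;
     rewrite negb_or ![w == _]eq_sym ?xw ?yw.
move=> C z u zC uC; have [s Ss [<- _]] := spanning_rot_to z Sc.
rewrite cycle_edges_cons ?spanning_uniq //=.
suff [x [d [xC dC xd]]] : exists x d, [/\ x \in C, d \notin C & [set x; d] \in walk_edges z s].
  by exists x, d; rewrite inE xd orbT.
have: u \in s by have := mem_spanning u Ss; rewrite inE => /orP[/eqP E|//]; rewrite E zC in uC.
elim: s z zC {Ss} => [//|y s IHs] z zC; rewrite inE => us.
have [yC|yC] := boolP (y \in C).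
  have {}us : u \in s by case/orP: us => // /eqP E; rewrite E yC in uC.
  have [x [d [xC dC xd]]] := IHs y yC us.
  by exists x, d; rewrite /= inE xd orbT.
by exists z, y; rewrite /= !inE eqxx.
Qed.

(** * Gaining edges of a target cycle

    A spanning linear forest is a list of paths [ps] with [spanning (flatten ps)]. *)
Definition forest_edges (T : finType) (ps : seq (seq T)) : {set {set T}} :=
  \bigcup_(p <- ps) path_edges p.

(** [L'] arises from [L] by deleting edges outside [H] and adding [j] edges of
    [H]. Deletions need not be counted: when a Hamiltonian cycle becomes a linear
    forest, their number is at most [j] plus the number of paths. *)
Definition gain (T : finType) (H : {set {set T}}) (j : nat) (L L' : {set {set T}}) : Prop :=
  [/\ L :&: H \subset L', L' \subset L :|: H & #|L' :&: H| = #|L :&: H| + j].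

Lemma setU1I_sub (T : finType) (H M : {set {set T}}) (e : {set T}) :
  e \notin H -> (e |: M) :&: H \subset M.
Proof.
move=> eH; rewrite setIUl subUset subsetIl andbT.
by apply/subsetP=> f; rewrite !inE => /andP[/eqP->]; rewrite (negPf eH).
Qed.

Lemma gain_trans (T : finType) (H L M N : {set {set T}}) (j k : nat) :
  gain H j L M -> gain H k M N -> gain H (j + k) L N.
Proof.
case=> LM ML cM [MN NM cN]; split.
- by apply: subset_trans MN; rewrite subsetI LM subsetIr.
- apply: subset_trans NM _; rewrite subUset ML; exact: subsetUr.
by rewrite cN cM addnA.
Qed.

Lemma gain_trim (T : finType) (H L M : {set {set T}}) :
  L :&: H \subset M -> M \subset L -> gain H 0 L M.
Proof.
move=> LM ML; split=> //; first by apply: subset_trans ML (subsetUl _ _).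
rewrite addn0; apply: eq_card => e; rewrite !inE; case eH: (e \in H); rewrite ?andbF // !andbT.
by apply/idP/idP => [/(subsetP ML)//|eL]; apply: (subsetP LM); rewrite inE eL.
Qed.

Lemma gain_add (T : finType) (H L : {set {set T}}) (e : {set T}) :
  e \in H -> e \notin L -> gain H 1 L (e |: L).
Proof.
move=> eH eL; split.
- by apply: subset_trans (subsetIl _ _) (subsetUr _ _).
- by rewrite subUset sub1set inE eH orbT subsetUl.
have -> : (e |: L) :&: H = e |: (L :&: H).
  by apply/setP=> f; rewrite !inE; case: eqP => // ->; rewrite eH.
by rewrite cardsU1 inE (negPf eL) addnC.
Qed.

Lemma flatten_cons (T : Type) (p : seq T) (ps : seq (seq T)) :
  flatten (p :: ps) = p ++ flatten ps.
Proof. by []. Qed.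

Lemma forest_edges_cons (T : finType) (p : seq T) (ps : seq (seq T)) :
  forest_edges (p :: ps) = path_edges p :|: forest_edges ps.
Proof. by rewrite /forest_edges big_cons. Qed.

Lemma forest_edges_perm (T : finType) (ps qs : seq (seq T)) :
  perm_eq ps qs -> forest_edges ps = forest_edges qs.
Proof. exact: perm_big. Qed.

Lemma forest_edges_mem (T : finType) (ps : seq (seq T)) (x y : T) :
  [set x; y] \in forest_edges ps -> (x \in flatten ps) && (y \in flatten ps).
Proof.
elim: ps => [|p ps IHps]; first by rewrite /forest_edges big_nil inE.
rewrite forest_edges_cons inE /= !mem_cat => /orP[/path_edges_mem|/IHps] /andP[-> ->] //.
by rewrite !orbT.
Qed.

(** The vertex [d] has degree two in [H] and spends one of its edges on [z],
    outside the path [q]. So one of the two edges of [q] at [d], if both are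
    there, is outside [H], and [q] can be cut at it. Reversing [q] if necessary
    puts the cut in front of [d]. *)
Lemma split_keeping (T : finType) (H : {set {set T}}) (q : seq T) (d z : T) :
  connected_2regular H -> uniq q -> d \in q -> z \notin q -> [set d; z] \in H ->
  exists q1 q2, [/\ perm_eq (q1 ++ d :: q2) q,
    path_edges q :&: H \subset path_edges q1 :|: path_edges (d :: q2) &
    path_edges q1 :|: path_edges (d :: q2) \subset path_edges q].
Proof.
move=> [_ deg2 _] Uq dq zq dz.
have cut q1 q2 x : path_edges (rcons q1 x ++ d :: q2) = path_edges q ->
    perm_eq (rcons q1 x ++ d :: q2) q -> [set d; x] \notin H ->
    exists q1 q2, [/\ perm_eq (q1 ++ d :: q2) q,
    path_edges q :&: H \subset path_edges q1 :|: path_edges (d :: q2) &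
    path_edges q1 :|: path_edges (d :: q2) \subset path_edges q].
  move=> <- pq xH; exists (rcons q1 x), q2; split=> //; rewrite path_edges_cat.
    by apply: setU1I_sub; rewrite setUC xH.
  exact: subsetUr.
have [q1 [q2 E]] : exists q1 q2, q = q1 ++ d :: q2.
  by case/splitPr: dq => q1 q2; exists q1, q2.
(* With [d] first on [q] there is nothing to cut, and [q1] is empty. *)
have [E1|[q1' [x E1]]] : q1 = [::] \/ exists q1' x, q1 = rcons q1' x.
- by case/lastP: (q1) => [|q1' x]; [left|right; exists q1', x].
  exists [::], q2; rewrite E E1 /=; split=> //; rewrite ?set0U ?subsetIl //.
have [xH|xH] := boolP ([set d; x] \in H); last first.
  by apply: (cut q1' q2 x) => //; rewrite E E1.
case: q2 E => [|y q2] E.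
  have Er : d :: rev q1 = rev q by rewrite E rev_cat.
  exists [::], (rev q1); rewrite cat0s Er path_edges_rev [path_edges [::]]/= set0U.
  by split; rewrite ?perm_rev ?subsetIl.
have yH : [set d; y] \notin H.
  apply: (deg2 d x z y) => //; rewrite E E1 in Uq zq *.
  move: Uq zq; rewrite cat_uniq rcons_uniq /= !mem_cat !mem_rcons !inE.
  rewrite !negb_or /=; case/and3P=> _ /and3P[_ /andP[xy _] _] _ /and3P[/andP[zx _] _ /andP[zy _]].
  by rewrite eq_sym zx eq_sym xy zy.
apply: (cut (rev q2) (rev q1) y) => //.
- have -> : rcons (rev q2) y ++ d :: rev q1 = rev q.
    by rewrite E rev_cat !rev_cons -!cats1 -!catA.
  exact: path_edges_rev.
have -> : rcons (rev q2) y ++ d :: rev q1 = rev q.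
  by rewrite E rev_cat !rev_cons -!cats1 -!catA.
by rewrite perm_rev.
Qed.

Lemma gain_trim_setU (T : finType) (H L M B : {set {set T}}) :
  L :&: H \subset M -> M \subset L -> gain H 0 (L :|: B) (M :|: B).
Proof.
move=> LM ML; apply: gain_trim; last exact: setSU.
by rewrite setIUl; exact: setUSS LM (subsetIl _ _).
Qed.

(** An edge of [H] from the end of a path to a different path can always be
    used: the other path is cut at [d], and joining one of the pieces to the
    first path cannot close a cycle. The other piece becomes a path of its own,
    so the number of paths is unchanged. *)
Lemma gain_attach (T : finType) (H : {set {set T}}) (z d : T) (p : seq T)
    (rest : seq (seq T)) :
  connected_2regular H -> uniq (flatten ((z :: p) :: rest)) ->
  d \in flatten rest -> [set d; z] \in H ->
  exists ps, [/\ perm_eq (flatten ps) (flatten ((z :: p) :: rest)),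
    size ps = size ((z :: p) :: rest) &
    gain H 1 (forest_edges ((z :: p) :: rest)) (forest_edges ps)].
Proof.
move=> HH U dr dz; have /flattenP[q qr dq] := dr.
have Er := perm_to_rem qr; set rs := rem q rest in Er.
have Pr : perm_eq ((z :: p) :: rest) [:: z :: p, q & rs] by rewrite perm_cons.
have Uf : uniq ((z :: p) ++ q ++ flatten rs) by rewrite -(perm_uniq (perm_flatten Pr)).
have Uq : uniq q by move: Uf; rewrite !cat_uniq => /and5P[].
have zq : z \notin q.
  by move: Uf; rewrite /= mem_cat mem_cat !negb_or => /andP[/and3P[]].
have [q1 [q2 [Pq s1 s2]]] := split_keeping HH Uq dq zq dz.
exists [:: q1, rev (z :: p) ++ d :: q2 & rs]; split.
- rewrite (permPr (perm_flatten Pr)) !flatten_cons -catA perm_catCA.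
  apply: perm_cat; first by rewrite perm_rev.
  by rewrite catA perm_cat2r.
- by rewrite (perm_size Pr).
rewrite (forest_edges_perm Pr) !forest_edges_cons rev_cons path_edges_cat.
rewrite -rev_cons path_edges_rev.
set A := path_edges (z :: p); set B := forest_edges rs.
have -> : path_edges q1 :|: ([set z; d] |: (A :|: path_edges (d :: q2)) :|: B) =
    [set z; d] |: (A :|: ((path_edges q1 :|: path_edges (d :: q2)) :|: B)).
  by rewrite -!setUA [LHS]setUCA (setUCA _ A).
rewrite (setUCA A) [X in gain _ _ _ (_ |: X)]setUCA.
apply: (gain_trans (j := 0)); first exact: gain_trim_setU s1 s2.
apply: gain_add; first by rewrite setUC.
have dA : d \notin z :: p.
  apply: contraL dr => dzp; move: U; rewrite flatten_cons cat_uniq => /and3P[_ /hasPn/(_ d) nd _].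
  by apply: contraTN dzp => /nd.
have zr : z \notin flatten rest by move: U; rewrite /= mem_cat negb_or => /andP[/andP[]].
have zdA : [set z; d] \notin A by apply: contra dA => /path_edges_mem/andP[].
rewrite setUCA inE (negPf zdA) orFb.
apply: contra zr; rewrite (perm_mem (perm_flatten Er)) => zd.
have : [set z; d] \in forest_edges (q :: rs).
  rewrite forest_edges_cons inE; case/setUP: zd => [/(subsetP s2)->|->]; rewrite ?orbT //.
by case/forest_edges_mem/andP.
Qed.

(** Since [c] spends an edge of [H] on [d] outside the cycle, one of its two
    edges on the cycle is outside [H]; deleting it makes [c] the end of a path. *)
Lemma open_cycle (T : finType) (H : {set {set T}}) (s : seq T) (c d : T) :
  connected_2regular H -> uniq s -> 2 < size s -> c \in s -> d \notin s ->
  [set c; d] \in H ->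
  exists p, [/\ perm_eq (c :: p) s,
    cycle_edges s :&: H \subset path_edges (c :: p) &
    path_edges (c :: p) \subset cycle_edges s].
Proof.
move=> [_ deg2 _] Us s3 cs ds cd; have [i t Et] := rot_to cs.
have Pt : perm_eq (c :: t) s by rewrite -Et perm_rot.
rewrite -(cycle_edges_rot i) // Et cycle_edges_cons ?(perm_uniq Pt) //.
have: uniq (c :: t) by rewrite (perm_uniq Pt).
have: 2 < size (c :: t) by rewrite (perm_size Pt).
have: d \notin c :: t by rewrite (perm_mem Pt).
move: Pt; case/lastP: t {Et} => [//|t l] Pt dt s3' Ut.
have [lH|lH] := boolP ([set c; l] \in H); last first.
  exists (rcons t l); split=> //; rewrite /= last_rcons; last exact: subsetUr.
  by apply: setU1I_sub; rewrite setUC lH.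
case: t => [|h t] in Pt dt s3' Ut *; first by [].
have hH : [set c; h] \notin H.
  apply: (deg2 c l d h) => //; move: Ut dt; rewrite /= !inE !mem_rcons !inE !negb_or /=.
  case/and3P=> _ /andP[hl _] _ /and4P[_ dh dl _].
  by rewrite eq_sym dl eq_sym hl dh.
exists (rev (h :: rcons t l)).
have -> : path_edges (c :: rev (h :: rcons t l)) =
    [set l; c] |: path_edges (h :: rcons t l).
  rewrite -(path_edges_rev (h :: rcons t l)) -[h :: rcons _ _]/(rcons (h :: t) l).
  by rewrite rev_rcons /= setUC [[set c; l]]setUC setUC.
split; rewrite /= ?last_rcons.
- by rewrite -(permPr Pt) perm_cons perm_rev.
- by rewrite setUCA; apply: setU1I_sub; rewrite hH.
by rewrite setUS // subsetUr.
Qed.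

Lemma forest_edges_nil (T : finType) (ps : seq (seq T)) :
  flatten ps = [::] -> forest_edges ps = set0.
Proof.
elim: ps => [|p ps IHps]; first by rewrite /forest_edges big_nil.
by rewrite forest_edges_cons; case: p => //= /IHps->; rewrite setU0.
Qed.

(** One round of the construction; the excess of gained edges over paths grows by
    one. The end [z] of some path has an edge [za] in [H] that is missing from
    the forest. If [a] is on another path, [gain_attach] applies. Otherwise [a]
    is further along the same path; if the edge before [a] is outside [H], it is
    exchanged for [za], which reverses an initial piece. If it is in [H], the
    edge after [a] is not, and cutting there makes [za] close a cycle, from which
    [H] escapes. The last alternative is that this cycle is spanning. *)
Lemma gain_progress (T : finType) (H : {set {set T}}) (ps : seq (seq T)) :
  connected_2regular H -> 2 < #|T| -> spanning (flatten ps) ->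
  (exists j ps', [/\ spanning (flatten ps'), gain H j (forest_edges ps) (forest_edges ps')
     & (j = 1 /\ size ps' = size ps) \/ (j = 2 /\ size ps' = (size ps).+1)]) \/
  (exists2 c, spanning c & gain H 1 (forest_edges ps) (cycle_edges c)).
Proof.
move=> HH n3 Sps; have [deg1 deg2 conn] := HH.
have [x0 _] : exists x0 : T, x0 \in T by apply/card_gt0P; apply: leq_trans n3.
have /flattenP[q qps] := mem_spanning x0 Sps.
case: q qps => // z p zps _.
have Pr := perm_to_rem zps; move: (rem _ _) Pr => rest Pr.
rewrite (perm_size Pr) (forest_edges_perm Pr).
have {Pr} {}Sps : spanning (flatten ((z :: p) :: rest)).
  by rewrite /spanning -(permPl (perm_flatten Pr)).
have U := spanning_uniq Sps.
have [a [az ap Ha]] := deg1 z (head z p).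
have := mem_spanning a Sps; rewrite flatten_cons mem_cat inE (negPf az) orFb.
case/orP=> [a_p|a_rest]; last first.
  left; exists 1; rewrite setUC in Ha.
  have [ps' [Pps' szps' Gps']] := gain_attach HH U a_rest Ha.
  by exists ps'; split; [rewrite /spanning (permPl Pps')| |left].
have [p1 [y [p2 Ep]]] : exists p1 y p2, p = rcons p1 y ++ a :: p2.
  case/splitPr: a_p ap => p1 p2; case/lastP: p1 => [|p1 y]; first by rewrite eqxx.
  by exists p1, y, p2.
rewrite {}Ep in U Sps *; move: ap a_p => _ _.
set B := forest_edges rest.
have zNf : z \notin flatten rest.
  by move: U; rewrite /= mem_cat negb_or => /andP[/andP[]].
have zaB : [set z; a] \notin B by apply: contra zNf => /forest_edges_mem/andP[].
have Uz : uniq (z :: rcons p1 y ++ a :: p2) by move: U; rewrite flatten_cons cat_uniq => /and3P[].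
have Ez : z :: rcons p1 y ++ a :: p2 = rcons (z :: p1) y ++ a :: p2 by [].
have aN : a \notin z :: rcons p1 y.
  move: Uz; rewrite -cat_cons cat_uniq => /and3P[_ /hasPn/(_ a) aN _].
  by apply: aN; rewrite inE eqxx.
have zN2 : z \notin a :: p2 by move: Uz; rewrite /= mem_cat negb_or => /andP[/andP[]].
have zaN : [set z; a] \notin path_edges (z :: rcons p1 y) :|: path_edges (a :: p2).
  rewrite inE negb_or; apply/andP; split.
    by apply: contra aN => /path_edges_mem/andP[].
  by apply: contra zN2 => /path_edges_mem/andP[].
(* The edge [ya] precedes [a] on the path, which starts at [z]. *)
have [yH|yH] := boolP ([set y; a] \in H); last first.
  left; exists 1, ((rev (z :: rcons p1 y) ++ a :: p2) :: rest); split; last by left.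
    apply: perm_trans Sps; rewrite !flatten_cons perm_cat2r -cat_cons perm_cat2r.
    by rewrite perm_rev.
  rewrite !forest_edges_cons rev_cons path_edges_cat -rev_cons path_edges_rev -/B -setUA.
  apply: (gain_trans (j := 0) (k := 1)); last first.
    by apply: gain_add => //; rewrite inE negb_or zaN.
  apply: gain_trim_setU; rewrite Ez path_edges_cat.
    by apply: setU1I_sub; rewrite yH.
  exact: subsetUr.
set s := z :: rcons (rcons p1 y) a.
have Es : z :: rcons p1 y ++ a :: p2 = s ++ p2.
  by rewrite /s cat_cons -[in RHS]cats1 -catA.
rewrite Es in U Sps *.
have Us : uniq s by move: U; rewrite flatten_cons !cat_uniq -andbA => /andP[].
have Ec : cycle_edges s = [set z; a] |: path_edges s.
  by rewrite cycle_edges_cons // last_rcons setUC [[set a; z]]setUC setUC.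
have zaF : [set z; a] \notin path_edges s :|: (path_edges p2 :|: B).
  rewrite !inE (negPf zaB) orbF negb_or; apply/andP; split.
    move: zaN; rewrite inE negb_or => /andP[zaN _].
    rewrite /s -rcons_cons -rcons_cons path_edges_rcons2 !inE negb_or zaN andbT.
    apply/negP=> /eqP/set2_inj[[zy _]|[za _]]; last by rewrite za eqxx in az.
    by move: Us; rewrite /s zy /= mem_rcons inE mem_rcons inE eqxx orbT.
  by apply: contra zN2 => /path_edges_mem/andP[zp2 _]; rewrite inE zp2 orbT.
(* The piece [s] from [z] to [a] is closed up by [za], after the edge from [a] to
   the rest [p2] of the path has been cut. *)
have G1 : gain H 1 (forest_edges ((s ++ p2) :: rest))
    (cycle_edges s :|: (path_edges p2 :|: B)).
  rewrite Ec -setUA; apply: (gain_trans (j := 0) (k := 1)); last exact: gain_add.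
  rewrite forest_edges_cons setUA; apply: gain_trim_setU.
    case: p2 U {zN2 zaN zaF Sps Uz Ez Es} => [|h p2] U; first by rewrite cats0 setU0 subsetIl.
    have ahH : [set a; h] \notin H.
      apply: (deg2 a z y h) => //; rewrite 1?setUC //.
      have hNs : h \notin s.
        move: U; rewrite flatten_cons -catA cat_uniq => /and3P[_ /hasPn/(_ h) hNs _].
        by apply: hNs; rewrite inE eqxx.
      move: Us hNs; rewrite /s /= !(inE, mem_rcons) !negb_or.
      case/andP=> /and3P[_ zy _] _ /and4P[hz _ hy _].
      by rewrite zy eq_sym hz eq_sym hy.
    rewrite [s ++ _](_ : _ = rcons (z :: rcons p1 y) a ++ h :: p2) // path_edges_cat.
    by apply: setU1I_sub; rewrite ahH.
  case: p2 {zN2 zaN zaF Sps U Uz Ez Es} => [|h p2]; first by rewrite cats0 setU0.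
  rewrite [s ++ _](_ : _ = rcons (z :: rcons p1 y) a ++ h :: p2) // path_edges_cat.
  exact: subsetUr.
(* If [H] cannot escape from [s], then [s] is a spanning cycle. *)
have [/allP sT|/allPn[u _ us]] := boolP (all (mem s) (enum T)).
  have Ss : spanning s.
    by apply: uniq_spanning => // x; apply: sT; rewrite mem_enum.
  right; exists s => //.
  have := spanning_size Sps; rewrite flatten_cons !size_cat (spanning_size Ss).
  rewrite -addnA -[RHS]addn0 => /addnI/eqP; rewrite addn_eq0 !size_eq0.
  case/andP=> /eqP E2 /eqP/forest_edges_nil EB.
  by move: G1; rewrite E2 /B EB !setU0.
have [c [d [cs ds cd]]] := conn (mem s) z u (mem_head _ _) us.
have s3 : 2 < size s by rewrite /= !size_rcons.
have [r [Pr trim1 trim2]] := open_cycle HH Us s3 cs ds cd.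
have Pf : perm_eq (flatten [:: c :: r, p2 & rest]) (flatten ((s ++ p2) :: rest)).
  by rewrite !flatten_cons -catA perm_cat2r.
have Uf : uniq (flatten [:: c :: r, p2 & rest]) by rewrite (perm_uniq Pf).
have d_rest : d \in flatten (p2 :: rest).
  have := mem_spanning d Sps; rewrite !flatten_cons -catA mem_cat; case/orP=> // ds'.
  by case/negP: ds.
rewrite setUC in cd.
have [ps' [Pps' szps' Gps']] := gain_attach HH Uf d_rest cd.
left; exists 2, ps'; split; last by right.
  by rewrite /spanning (permPl Pps') (permPl Pf).
apply: (gain_trans (j := 1) (k := 1)) G1 _.
apply: (gain_trans (j := 0) (k := 1)) Gps'.
rewrite !forest_edges_cons; exact: gain_trim_setU.
Qed.

Lemma path_edges_cat_sub (T : finType) (p s : seq T) :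
  exists e, path_edges (p ++ s) \subset e |: (path_edges p :|: path_edges s).
Proof.
case/lastP: p => [|p x]; first by exists set0; rewrite /= set0U subsetUr.
case: s => [|y s]; first by exists set0; rewrite cats0 setU0 subsetUr.
by exists [set x; y]; rewrite path_edges_cat.
Qed.

(** * Two rounds give a profitable forest *)
Lemma card_joints (T : finType) (p : seq T) (ps : seq (seq T)) :
  #|path_edges (flatten (p :: ps)) :\: forest_edges (p :: ps)| <= size ps.
Proof.
elim: ps p => [|q ps IHps] p.
  by rewrite flatten_cons cats0 forest_edges_cons leqn0 cards_eq0 setD_eq0 subsetUl.
rewrite flatten_cons forest_edges_cons.
have [e sub] := path_edges_cat_sub p (flatten (q :: ps)).
have sub2 : path_edges (p ++ flatten (q :: ps)) :\: (path_edges p :|: forest_edges (q :: ps))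
    \subset e |: (path_edges (flatten (q :: ps)) :\: forest_edges (q :: ps)).
  apply/subsetP=> f; rewrite !(inE, negb_or) => /andP[/andP[fp fps] /(subsetP sub)].
  by rewrite !inE (negPf fp) orFb fps.
apply: leq_trans (subset_leq_card sub2) _.
by apply: leq_trans (leq_card_setU _ _) _; rewrite cards1 add1n ltnS.
Qed.

Lemma card_closing_edges (T : finType) (p : seq T) (ps : seq (seq T)) :
  uniq (flatten (p :: ps)) -> 
  #|cycle_edges (flatten (p :: ps)) :\: forest_edges (p :: ps)| <= (size ps).+1.
Proof.
have := card_joints p ps; case: (flatten _) => [_ _|x s le U].
  rewrite -[X in X <= _](_ : 0 = _) //; symmetry; apply: eq_card0 => e.
  by rewrite !inE andbC; apply/negP=> /andP[/imsetP[]].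
rewrite cycle_edges_cons // setDUl (leq_trans (leq_card_setU _ _)) //.
rewrite -add1n leq_add // -[X in _ <= X](cards1 [set last x s; x]).
by rewrite subset_leq_card // subsetDl.
Qed.

Lemma forest_edges_sub_cycle (T : finType) (ps : seq (seq T)) :
  uniq (flatten ps) -> forest_edges ps \subset cycle_edges (flatten ps).
Proof.
move=> U; apply: (@subset_trans _ _ (path_edges (flatten ps))).
  elim: ps {U} => [|p ps IHps]; first by rewrite /forest_edges big_nil sub0set.
  rewrite forest_edges_cons flatten_cons subUset; apply/andP; split.
    case/lastP: p => [|p x]; first by rewrite sub0set.
    case: (flatten ps) => [|y s]; first by rewrite cats0.
    by rewrite path_edges_cat setUCA subsetUl.
  apply: subset_trans IHps _.
  case/lastP: p => [|p x] //; case: (flatten ps) => [|y s]; first by rewrite sub0set.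
  by rewrite path_edges_cat setUA subsetUr.
case: (flatten ps) U => [|x s] U; first by rewrite sub0set.
by rewrite cycle_edges_cons // subsetUr.
Qed.

(** Linear forests with [v] paths and Hamiltonian cycles (with [v] = 0) at once:
    [L] lies on a Hamiltonian cycle of the complete graph at the cost of [v]
    foreign edges. *)
Definition almost_hamiltonian (T : finType) (v : nat) (L : {set {set T}}) : Prop :=
  exists c, [/\ spanning c, L \subset cycle_edges c & #|cycle_edges c :\: L| <= v].

Lemma forest_almost_hamiltonian (T : finType) (ps : seq (seq T)) :
  0 < #|T| -> spanning (flatten ps) -> almost_hamiltonian (size ps) (forest_edges ps).
Proof.
move=> n0 Sps; exists (flatten ps); split=> //.
  exact: forest_edges_sub_cycle (spanning_uniq Sps).
case: ps Sps => [|p ps] Sps; last exact: card_closing_edges (spanning_uniq Sps).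
by move: n0; rewrite -(spanning_size Sps).
Qed.

Lemma cycle_almost_hamiltonian (T : finType) (c : seq T) :
  spanning c -> almost_hamiltonian 0 (cycle_edges c).
Proof. by move=> Sc; exists c; rewrite setDv cards0. Qed.

Lemma cycle_edges_cut (T : finType) (c : seq T) (u : T) :
  2 < #|T| -> spanning c -> exists s, let p := next c u :: rcons s u in
    [/\ spanning p, cycle_edges c = [set u; next c u] |: path_edges p &
      next p =1 next c].
Proof.
move=> n3 Sc; have [[|y s] [Ss [Es En]]] := spanning_rot_to u Sc.
  by rewrite -(spanning_size Ss) in n3.
have Ey : next c u = y by rewrite -En /= eqxx.
have Er : y :: rcons s u = rot 1 (u :: y :: s) by rewrite rot1_cons.
have Us := spanning_uniq Ss.
have Sr : spanning (y :: rcons s u) by rewrite Er /spanning perm_rot.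
exists s => /=; rewrite Ey; split=> //; last by move=> x; rewrite Er next_rot.
rewrite -Es -(cycle_edges_rot 1) // -Er cycle_edges_cons ?(spanning_uniq Sr) //.
by rewrite last_rcons.
Qed.

(** The bound [2 * v + b] is the size of the final switch: [v + b] edges are
    deleted to reach [L] and up to [v] more to close it. Starting with one path
    and no gain, each round adds (0, 1) or (1, 2) to the pair (paths, gain), so
    the worst outcome is three paths and a gain of four. *)
Lemma gain_almost_hamiltonian (T : finType) (c1 c2 : seq T) :
  2 < #|T| -> spanning c1 -> spanning c2 -> cycle_edges c1 != cycle_edges c2 ->
  exists v b L, [/\ almost_hamiltonian v L,
    gain (cycle_edges c2) b (cycle_edges c1) L & (v < b) && (2 * v + b <= 10)].
Proof.
move=> n3 S1 S2 neq; set H := cycle_edges c2 in neq *.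
have HH : connected_2regular H by apply: cycle_edges_2regular.
have n0 : 0 < #|T| by apply: leq_trans n3.
have /subsetPn[_ /imsetP[w _ ->] wH] : ~~ (cycle_edges c1 \subset H).
  by apply: contra neq => sub; rewrite eqEcard sub /H !card_cycle_edges ?leqnn.
have [s [Sp Ec1 _]] := cycle_edges_cut w n3 S1; set p := _ :: _ in Sp Ec1.
have G0 : gain H 0 (cycle_edges c1) (forest_edges [:: p]).
  rewrite /forest_edges big_seq1 Ec1; apply: gain_trim; last exact: subsetUr.
  by apply: setU1I_sub; rewrite wH.
have Sf : spanning (flatten [:: p]) by rewrite flatten_cons cats0.
have [[j [ps [Sps Gps szps]]]|[c Sc Gc]] := gain_progress HH n3 Sf; last first.
  exists 0, 1, (cycle_edges c).
  by split; [exact: cycle_almost_hamiltonian|exact: gain_trans G0 Gc|].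
have [[k [qs [Sqs Gqs szqs]]]|[c Sc Gc]] := gain_progress HH n3 Sps; last first.
  exists 0, (j + 1), (cycle_edges c); split; first exact: cycle_almost_hamiltonian.
    exact: gain_trans G0 (gain_trans Gps Gc).
  move: szps => /=. lia.
exists (size qs), (j + k), (forest_edges qs); split.
- exact: forest_almost_hamiltonian.
- exact: gain_trans G0 (gain_trans Gps Gqs).
by move: szps szqs => /=; lia.
Qed.

(** * Closing up inside the graph *)
Definition graph_edges (G : sgraph) : {set {set G}} :=
  [set [set p.1; p.2] | p in [pred p : G * G | edge p.1 p.2]].

Lemma mem_graph_edges (G : sgraph) (x y : G) :
  ([set x; y] \in graph_edges G) = edge x y.
Proof.
apply/imsetP/idP => [[[a b] /= eab /set2_inj[[-> ->]|[-> ->]]]|exy] //.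
  by rewrite edge_sym.
by exists (x, y).
Qed.

Lemma ham_cyclesP (G : sgraph) (H : {set {set G}}) :
  reflect (exists c, [/\ 2 < #|G|, spanning c, H = cycle_edges c &
             cycle_edges c \subset graph_edges G])
    (H \in ham_cycles G).
Proof.
apply: (iffP imsetP) => [[c]|[c [n3 Sc -> sub]]].
  rewrite inE => /andP[n3 /andP[cyc Uc]] ->; exists c; split=> //.
    have sub : {subset c <= enum G} by move=> y _; rewrite mem_enum.
    have sz : size (enum G) <= size c by rewrite -cardE size_tuple.
    by apply: uniq_spanning => // x; rewrite (uniq_min_size Uc sub sz).2 mem_enum.
  apply/subsetP=> _ /imsetP[x xc ->]; rewrite mem_graph_edges; exact: next_cycle.
have szc : size c == #|G| by rewrite spanning_size.
exists (Tuple szc) => //; rewrite inE n3 /=.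
rewrite /ucycleb (spanning_uniq Sc) andbT.
apply: cycle_from_next (spanning_uniq Sc) _ => x xc.
by rewrite -mem_graph_edges (subsetP sub) //; apply/imsetP; exists x.
Qed.

Lemma next_cat_cons (T : eqType) (p q : seq T) (a b : T) :
  uniq (p ++ [:: a, b & q]) -> next (p ++ [:: a, b & q]) a = b.
Proof.
move=> U; rewrite -(next_rot (size p) U) rot_size_cat /=.
by rewrite eqxx.
Qed.

(** Cut the cycle at its edge [uw] outside the graph. More than half of all
    vertices are adjacent to [w], and more than half follow a neighbour of [u] on
    the cycle, so some neighbour [b] of [w] follows a neighbour [a] of [u].
    Reversing the path from [w] to [a] trades [uw] and [ab] for [ua] and [wb]. *)
Lemma ore_exchange (G : sgraph) (c : seq G) :
  2 < #|G| -> (forall v : G, #|G| < 2 * degree v) -> spanning c ->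
  ~~ (cycle_edges c \subset graph_edges G) ->
  exists c', [/\ spanning c',
    #|cycle_edges c' :\: graph_edges G| < #|cycle_edges c :\: graph_edges G| &
    #|(cycle_edges c :&: graph_edges G) :\: cycle_edges c'| <= 1].
Proof.
move=> n3 deg Sc /subsetPn[_ /imsetP[u _ ->]]; set w := next c u => uwE.
have [s [Sp Ec En]] := cycle_edges_cut u n3 Sc; rewrite -/w in Sp Ec En uwE.
have [b] : exists b, b \in [set x | edge w x] :&: (next c @: [set x | edge u x]).
  apply/set0Pn; rewrite -card_gt0.
  have := cardsUI [set x | edge w x] (next c @: [set x | edge u x]).
  rewrite card_imset; last exact: can_inj (prev_next (spanning_uniq Sc)).
  have := max_card ([set x | edge w x] :|: next c @: [set x | edge u x]).
  by have := deg u; have := deg w; rewrite /degree; lia.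
rewrite !inE => /andP[wb /imsetP[a]]; rewrite inE => ua Eb.
have au : a != u by apply: contraTneq ua => ->; rewrite edge_irr.
have Up := spanning_uniq Sp.
have [p1 [p2 Ep]] : exists p1 p2, w :: rcons s u = p1 ++ [:: a, b & p2].
  have [p1 [q Ep]] : exists p1 q, w :: rcons s u = p1 ++ a :: q.
    by case/splitPr: (mem_spanning a Sp) => p1 q; exists p1, q.
  case: q Ep => [|b' q] Ep.
    have := congr1 (last w) Ep; rewrite last_cat /= last_rcons => ua'.
    by rewrite ua' eqxx in au.
  have Eb' : b = b' by rewrite Eb -En Ep next_cat_cons // -Ep.
  by exists p1, q; rewrite Eb'.
have Ew : rcons p1 a = w :: behead (rcons p1 a).
  by case: (p1) Ep => [|x p1'] /= [-> _].
have Eu : last b p2 = u.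
  by have := congr1 (last w) Ep; rewrite last_cat /= last_rcons.
set A := path_edges (rcons p1 a) :|: path_edges (b :: p2).
have Ecp : cycle_edges c = [set u; w] |: ([set a; b] |: A).
  by rewrite Ec Ep -(cat_rcons a) path_edges_cat.
have Pc' : perm_eq (rev (rcons p1 a) ++ b :: p2) (w :: rcons s u).
  by rewrite Ep -(cat_rcons a) perm_cat2r perm_rev.
have Sc' : spanning (rev (rcons p1 a) ++ b :: p2) by apply: perm_trans Pc' Sp.
have Ec' : cycle_edges (rev (rcons p1 a) ++ b :: p2) = [set u; a] |: ([set w; b] |: A).
  have -> : [set w; b] |: A = path_edges (rev (rcons p1 a) ++ b :: p2).
    by rewrite [in RHS]Ew rev_cons path_edges_cat -rev_cons -Ew path_edges_rev.
  move: (spanning_uniq Sc'); rewrite rev_rcons cat_cons => Uc'.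
  by rewrite cycle_edges_cons // last_cat /= Eu.
have uaE : [set u; a] \in graph_edges G by rewrite mem_graph_edges.
have wbE : [set w; b] \in graph_edges G by rewrite mem_graph_edges.
have uwA : [set u; w] \notin A.
  have uR : u \in b :: p2 by rewrite -Eu mem_last.
  have wL : w \in rcons p1 a by rewrite Ew mem_head.
  move: Up; rewrite Ep -(cat_rcons a) cat_uniq => /and3P[_ /hasPn dis _].
  rewrite inE negb_or; apply/andP; split; apply/negP=> /path_edges_mem/andP[].
    by rewrite (negPf (dis u uR)).
  by move=> _ /dis; rewrite wL.
exists (rev (rcons p1 a) ++ b :: p2); split=> //.
  rewrite Ecp Ec'; apply: proper_card; apply/properP; split; last first.
    exists [set u; w]; first by rewrite inE uwE setU11.
    rewrite in_setD !in_setU1 uwE (negPf uwA) orbF.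
    apply/negP=> /orP[] /eqP E; first by rewrite E uaE in uwE.
    by rewrite E wbE in uwE.
  apply/subsetP=> e; rewrite !in_setD !in_setU1 => /andP[eE].
  case/or3P=> [/eqP Ee|/eqP Ee|->]; rewrite ?orbT ?eE //.
    by rewrite Ee uaE in eE.
  by rewrite Ee wbE in eE.
rewrite -(cards1 [set a; b]) subset_leq_card //; apply/subsetP=> e.
rewrite Ecp Ec' in_setD in_setI !in_setU1 !negb_or in_set1.
case/andP=> /and3P[_ _ eA] /andP[/or3P[/eqP Ee|//|eA'] eE].
  by rewrite Ee (negPf uwE) in eE.
by rewrite eA' in eA.
Qed.

Lemma ore_closing (G : sgraph) (c : seq G) :
  2 < #|G| -> (forall v : G, #|G| < 2 * degree v) -> spanning c ->
  exists c', [/\ spanning c', cycle_edges c' \subset graph_edges G &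
    #|(cycle_edges c :&: graph_edges G) :\: cycle_edges c'|
      <= #|cycle_edges c :\: graph_edges G|].
Proof.
move=> n3 deg; have [k] := ubnP #|cycle_edges c :\: graph_edges G|.
elim: k c => // k IHk c; rewrite ltnS => ck Sc.
have [sub|nsub] := boolP (cycle_edges c \subset graph_edges G).
  by exists c; rewrite (setIidPl sub) setDv cards0.
have [d [Sd ltd loss]] := ore_exchange n3 deg Sc nsub.
have [c' [Sc' sub loss']] := IHk d (leq_trans ltd ck) Sd.
exists c'; split=> //; apply: leq_trans ltd; rewrite -addn1 addnC.
apply: leq_trans (leq_add loss loss').
apply: leq_trans (leq_card_setU _ _); apply: subset_leq_card; apply/subsetP=> e.
by rewrite !inE; case: (e \in cycle_edges d); case/and3P=> -> -> ->.
Qed.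

(** * Switching towards the target *)

(** The forest of [gain_almost_hamiltonian] contains [b] more edges of [H2] than
    [H1] does, and Ore's exchanges lose at most [v < b] of its edges. *)
Lemma closer_hamiltonian_cycle (G : sgraph) (H1 H2 : {set {set G}}) :
  (forall v : G, #|G| < 2 * degree v) ->
  H1 \in ham_cycles G -> H2 \in ham_cycles G -> H1 != H2 ->
  exists H3, is_kswitch 10 H1 H3 /\ #|H2 :\: H3| < #|H2 :\: H1|.
Proof.
move=> deg HH1 HH2; have /ham_cyclesP[c1 [n3 S1 E1 sub1]] := HH1.
have /ham_cyclesP[c2 [_ S2 E2 sub2]] := HH2; rewrite E1 E2 => neq.
have [v [b [L [[c [Sc Lc cL]] [FL LH cFL] bounds]]]] := gain_almost_hamiltonian n3 S1 S2 neq.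
have [c' [Sc' sub' loss]] := ore_closing n3 deg Sc.
rewrite -{}E1 -{}E2 in FL LH cFL sub1 sub2 neq *; set H3 := cycle_edges c'.
have HH3 : H3 \in ham_cycles G by apply/ham_cyclesP; exists c'.
have sz H : H \in ham_cycles G -> #|H| = #|G|.
  by case/ham_cyclesP=> d [_ Sd -> _]; exact: card_cycle_edges.
have LE : L \subset graph_edges G.
  by apply: subset_trans LH _; rewrite subUset sub1 sub2.
have lossL : #|L :\: H3| <= v.
  apply: leq_trans cL; apply: leq_trans (leq_trans loss _).
    by apply: subset_leq_card; apply: setSD; rewrite subsetI Lc.
  by apply: subset_leq_card; exact: setDS.
have szL : #|G| <= #|L| + v.
  rewrite -(card_cycle_edges Sc n3) -(cardsID L (cycle_edges c)) (setIidPr Lc).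
  by rewrite leq_add2l.
have LH1 : #|L :\: H1| <= b.
  have subF : H1 :&: H2 \subset L :&: H2 by rewrite subsetI FL subsetIr.
  rewrite -(addKn #|H1 :&: H2| b) -cFL -(cardsDS subF).
  apply: subset_leq_card; apply/subsetP=> e; rewrite !inE => /andP[e1 eL].
  by have := subsetP LH e eL; rewrite !inE (negPf e1) eL /= => ->.
have H1L := cardsID L H1; have LL1 := cardsID H1 L; rewrite setIC in LL1.
have H13 : #|H1 :\: H3| <= #|H1 :\: L| + #|L :\: H3|.
  apply: leq_trans (leq_card_setU _ _); apply: subset_leq_card; apply/subsetP=> e.
  by rewrite !inE; case: (e \in L); case/andP=> -> ->.
have H23 : #|L :&: H2| <= #|H2 :&: H3| + #|L :\: H3|.
  apply: leq_trans (leq_card_setU _ _); apply: subset_leq_card; apply/subsetP=> e.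
  by rewrite !inE; case: (e \in H3); case/andP=> -> ->.
have C13 := cardsID H3 H1; have C31 := cardsID H1 H3; rewrite setIC in C31.
have C23 := cardsID H3 H2; have C21 := cardsID H1 H2; rewrite setIC in C21.
have s1 := sz _ HH1; have s2 := sz _ HH2; have s3 := sz _ HH3.
have {}cFL : #|L :&: H2| = #|H1 :&: H2| + b := cFL.
have arith : (#|H1 :\: H3| < 11) && (#|H3 :\: H1| == #|H1 :\: H3|) && (#|H2 :\: H3| < #|H2 :\: H1|).
  move: bounds cFL lossL szL LH1 H1L LL1 H13 H23 C13 C31 C23 C21 s1 s2 s3.
  (* All that remains is linear arithmetic in the cardinals, made into variables. *)
  clear; repeat match goal with |- context [@card ?U ?A] => generalize (@card U A); intro end.
  lia.
case/andP: arith => /andP[lt10 eq31] lt23; exists H3; split=> //.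
by apply/existsP; exists (Ordinal lt10); rewrite /is_switch HH1 HH3 eqxx.
Qed.

Lemma degree_gt_half (G : sgraph) (v : G) :
  large_min_degree G -> #|G| < 2 * degree v.
Proof.
move=> large; have min_le : min_degree G <= degree v.
  rewrite /min_degree; elim: (index_enum G) (mem_index_enum v) => // w s IHs.
  rewrite inE big_cons geq_min => /orP[/eqP->|/IHs->]; by rewrite ?leqnn ?orbT.
have : ((#|G| + 14)%:R <= (2 * min_degree G)%:R :> rat)%R.
  move: large; rewrite /large_min_degree GRing.natrD GRing.natrM; lra.
rewrite Num.Theory.ler_nat; lia.
Qed.

Lemma kswitch_sequence_exists (G : sgraph) (H1 H2 : {set {set G}}) :
  large_min_degree G -> H1 \in ham_cycles G -> H2 \in ham_cycles G ->
  exists p, kswitch_sequence 10 H1 H2 p /\ size p <= #|H2 :\: H1|.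
Proof.
move=> large HH1 HH2; have deg v := degree_gt_half v large.
have [k] := ubnP #|H2 :\: H1|.
elim: k H1 HH1 => // k IHk H1 HH1; rewrite ltnS => dk.
have [<-|neq] := eqVneq H1 H2.
  exists [::]; split=> //; split=> // H; by rewrite inE => /eqP->.
have [H3 [sw lt]] := closer_hamiltonian_cycle deg HH1 HH2 neq.
have HH3 : H3 \in ham_cycles G by case/existsP: sw => j /and4P[].
have [p [[sub pth lst] szp]] := IHk H3 HH3 (leq_trans lt dk).
exists (H3 :: p); split; last exact: leq_ltn_trans lt.
split=> //=; last by rewrite sw.
by move=> H; rewrite inE => /orP[/eqP->|/sub].
Qed.

Theorem theorem3p1 :
  (forall G : sgraph, large_min_degree G -> kswitch_irreducible 10 G) /\
  strongly_kswitch_irreducible 10 large_min_degree.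
Proof.
split=> [G large H1 H2 HH1 HH2|].
  by have [p [seq_p _]] := kswitch_sequence_exists large HH1 HH2; exists p.
exists succn => G large x H1 H2 HH1 HH2 le_x.
have [p [seq_p size_p]] := kswitch_sequence_exists large HH1 HH2.
exists p; split=> //; rewrite ltnS (leq_trans size_p) // (leq_trans _ le_x) //.
by rewrite subset_leq_card // subsetUr.
Qed.
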